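(* Let $G$ be a finite group. Then the undirected power graph $\mathcal{P}(G)$ is (isomorphic to) an undirected Cayley graph of some group if and only if $G$ is a cyclic $p$-group for some prime $p$.
   Context: For a finite group $G$, the undirected power graph $\mathcal{P}(G)$ is the simple graph with vertex set $G$ in which two distinct vertices $x,y$ are adjacent if and only if one of them is a positive integer power of the other. For a group $H$ and an inverse-closed subset $C\subseteq H\setminus\{e\}$, the undirected Cayley graph $X(H,C)$ has vertex set $H$, with distinct $g,h$ adjacent if and only if $g^{-1}h\in C$. A cyclic $p$-group is a cyclic group whose order is a power of a prime $p$. *)

(* Defs.v *)
From HB Require Import structures.
From mathcomp Require Import all_boot all_fingroup all_solvable.

Set Implicit Arguments.
Unset Strict Implicit.
Unset Printing Implicit Defensive.

Import GroupScope.

Record sgraph := SGraph {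
  vertex :> Type;
  adj : vertex -> vertex -> Prop;
  adj_irrefl : forall x, ~ adj x x;
  adj_sym : forall x y, adj x y -> adj y x }.

Definition graph_iso (A B : sgraph) : Prop :=
  exists f : A -> B, bijective f /\ forall x y, adj x y <-> adj (f x) (f y).

Section PowerGraph.
Variable G : finGroupType.
Implicit Types x y : G.

Definition pos_power x y : Prop := exists n : nat, (0 < n)%N /\ y = x ^+ n.

Definition power_adj x y : Prop := x <> y /\ (pos_power x y \/ pos_power y x).

Lemma power_adj_irrefl x : ~ power_adj x x.
Proof. by case. Qed.

Lemma power_adj_sym x y : power_adj x y -> power_adj y x.
Proof. by case=> nxy [] p; split; auto. Qed.

Definition power_graph : sgraph := SGraph power_adj_irrefl power_adj_sym.

End PowerGraph.

Section CayleyGraph.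
(* [H] may be infinite: [groupType] is the library type of arbitrary groups. *)
Variables (H : groupType) (C : H -> Prop).

Definition cayley_adj (g h : H) : Prop := g <> h /\ C (g^-1 * h).

Lemma cayley_adj_irrefl g : ~ cayley_adj g g.
Proof. by case. Qed.

Hypothesis CV : forall c, C c -> C c^-1.

Lemma cayley_adj_sym g h : cayley_adj g h -> cayley_adj h g.
Proof.
by case=> ngh Cgh; split; [auto | move/CV: Cgh; rewrite invgM invgK].
Qed.

(* The unused argument [~ C 1] is not needed to build the graph; it ensures that
   the connection set is contained in H \ {1}. *)
Definition cayley_graph of ~ C 1 : sgraph :=
  SGraph cayley_adj_irrefl cayley_adj_sym.

End CayleyGraph.

Definition is_cayley_graph (A : sgraph) : Prop :=
  exists (H : groupType) (C : H -> Prop)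
         (CV : forall c, C c -> C c^-1) (C1 : ~ C 1),
    graph_iso A (cayley_graph CV C1).

(* Main.v *)
(* The identity is adjacent to every other vertex of a power graph, and Cayley
   graphs are vertex-transitive; so the power graph of G is a Cayley graph
   exactly when it is complete, that is, when the cyclic subgroups of G form a
   chain. Then an element of maximal order generates G, and by Cauchy's theorem
   only one prime can divide its order. *)
Require Import Defs.
From mathcomp Require Import all_boot all_fingroup all_solvable.

Set Implicit Arguments.
Unset Strict Implicit.
Unset Printing Implicit Defensive.

Local Open Scope group_scope.

Lemma pos_powerP (G : finGroupType) (x y : G) :
  pos_power x y <-> y \in <[x]>.
Proof.
split=> [[n [_ ->]] | /cycleP[n ->]]; first exact: mem_cycle.
(* Adding the order of [x] keeps the power and makes the exponent positive, even when [n] is 0. *)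
exists (n + #[x])%N; split; first by rewrite addn_gt0 order_gt0 orbT.
by rewrite expgD expg_order mulg1.
Qed.

Lemma power_adj1 (G : finGroupType) (x : G) : 1 <> x -> power_adj 1 x.
Proof. by move=> ne1x; split=> //; right; apply/pos_powerP; exact: group1. Qed.

Definition complete (A : sgraph) : Prop := forall x y : A, x <> y -> adj x y.

Lemma universal_vertex_complete (A : sgraph) (u : A) :
  is_cayley_graph A -> (forall x, u <> x -> adj u x) -> complete A.
Proof.
case=> H [C [CV [C1 [f [[g fK gK] fE]]]]] univ x y nexy.
apply/fE; have nefxy : f x <> f y by move/(can_inj fK).
split=> //.
(* Translate the pair (f x, f y) so that it starts at f u. *)
set h := f u * ((f x)^-1 * f y).
have neuh : u <> g h.
  move=> /(congr1 f); rewrite gK -[LHS]mulg1 => /mulgI/esym eq1.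
  by apply: nefxy; rewrite -[f y](mulKVg (f x)) eq1 mulg1.
by have /fE[_] := univ _ neuh; rewrite gK mulKg.
Qed.

(** With all non-identity elements as connection set, the Cayley graph is complete, so any bijection
    is an isomorphism. *)
Lemma complete_cayley (G : groupType) (A : sgraph) (f : A -> G) :
  bijective f -> complete A -> is_cayley_graph A.
Proof.
move=> bijf complA.
have CV (c : G) : c <> 1 -> c^-1 <> 1.
  by move=> nec1 /(congr1 (@inv G)); rewrite invgK invg1.
have C1 : ~ ((1 : G) <> 1) by apply.
exists G, (fun c => c <> 1), CV, C1, f; split=> // x y; split=> [adjxy | [nefxy _]].
  have nefxy : f x <> f y.
    by move/(bij_inj bijf)=> eqxy; move: adjxy; rewrite eqxy; apply: adj_irrefl.
  split=> // eq1; apply: nefxy.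
  by rewrite -[f y](mulKVg (f x)) eq1 mulg1.
by apply: complA => eqxy; apply: nefxy; rewrite eqxy.
Qed.

Lemma complete_power_graphP (G : finGroupType) :
  complete (power_graph G) <->
  forall x y : G, (x \in <[y]>) || (y \in <[x]>).
Proof.
split=> [complG x y | chainG x y nexy].
  have [-> | /eqP/complG[_ [/pos_powerP-> | /pos_powerP->]]] := eqVneq x y.
  - by rewrite cycle_id.
  - by rewrite orbT.
  - by [].
by split=> //; case/orP: (chainG x y) => /pos_powerP; [right | left].
Qed.

Lemma cycle_chain_cyclic (G : finGroupType) :
  (forall x y : G, (x \in <[y]>) || (y \in <[x]>)) -> cyclic [set: G].
Proof.
move=> chainG.
case: (@arg_maxnP G 1 xpredT (fun x => #[x])) => // x _ maxx.
apply/cyclicP; exists x; apply/eqP; rewrite eq_sym eqEsubset subsetT.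
apply/subsetP=> y _; case/orP: (chainG y x) => // xy.
(* Here [<[x]>] lies in [<[y]>], and maximality of [#[x]] forces equality. *)
have /eqP-> : <[x]> == <[y]> by rewrite eqEcard cycle_subG xy; exact: maxx.
exact: cycle_id.
Qed.

Lemma cycle_chain_pgroup (G : finGroupType) :
  (forall x y : G, (x \in <[y]>) || (y \in <[x]>)) ->
  exists2 p, prime p & p.-group [set: G].
Proof.
move=> chainG; have [G1 | ntG] := eqVneq #|[set: G]| 1%N.
  (* The trivial group is a p-group for every prime; 2 is an arbitrary choice. *)
  by exists 2; rewrite // /pgroup G1.
have p_pr : prime (pdiv #|[set: G]|) by rewrite pdiv_prime // ltn_neqAle eq_sym ntG cardG_gt0.
exists (pdiv #|[set: G]|) => //.
apply/pgroupP=> q q_pr /(Cauchy q_pr)[y _ oy].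
have [x _ ox] := Cauchy p_pr (pdiv_dvd _).
(* Whichever of [x], [y] lies in the cycle of the other, one prime order divides the other, so the
   two primes agree. *)
rewrite inE /= -ox -oy; case/orP: (chainG x y) => /order_dvdG.
  by rewrite -orderE ox oy dvdn_prime2 // eq_sym.
by rewrite -orderE ox oy dvdn_prime2.
Qed.

(** In a cyclic group, inclusion of subgroups amounts to divisibility of their orders, and powers of
    [p] are totally ordered by divisibility. *)
Lemma cyclic_pgroup_cycle_chain (G : finGroupType) (p : nat) :
  cyclic [set: G] -> p.-group [set: G] ->
  forall x y : G, (x \in <[y]>) || (y \in <[x]>).
Proof.
move=> cycG pG x y.
have chain_of_dvd (u v : G) : #[u] %| #[v] -> u \in <[v]>.
  by move=> dvd_uv; rewrite -cycle_subG -(cardSg_cyclic cycG) ?subsetT.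
have /p_natP[a ox] : p.-nat #[x] by apply: mem_p_elt pG _; rewrite inE.
have /p_natP[b oy] : p.-nat #[y] by apply: mem_p_elt pG _; rewrite inE.
by apply/orP; case/orP: (leq_total a b) => /(dvdn_exp2l p) le_ab;
  [left | right]; apply: chain_of_dvd; rewrite ox oy.
Qed.

Theorem theorem2p1 (G : finGroupType) :
  is_cayley_graph (power_graph G) <->
  exists p : nat, [/\ prime p, cyclic [set: G] & p.-group [set: G]].
Proof.
split=> [cayG | [p [_ cycG pG]]].
  have /complete_power_graphP chainG : complete (power_graph G).
    exact: universal_vertex_complete cayG (@power_adj1 G).
  have [p p_pr pG] := cycle_chain_pgroup chainG.
  by exists p; split=> //; apply: cycle_chain_cyclic.
(* The vertices are the elements of [G], so [G] itself serves as the group. *)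
apply: (@complete_cayley G (power_graph G) id); first by exists id.
by apply/complete_power_graphP; apply: cyclic_pgroup_cycle_chain pG.
Qed.
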